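(* Let $G$ be a non-archimedean, Roelcke precompact Polish group and let $G^\circ$ be the intersection of all open subgroups of finite index in $G$. Suppose $G^\circ \neq \{1_G\}$. Then there exist $f, g \in G^\circ$ which generate a (non-abelian) free subgroup $F$ of $G^\circ$ with the property that if $H \leq G$ is open and of infinite index, then $F$ acts freely on the coset space $G/H$ (by left translation).
   Context: A topological group is non-archimedean if it has a base of open neighbourhoods of the identity consisting of subgroups. A topological group $G$ is Roelcke precompact if for every open neighbourhood $U$ of the identity there is a finite set $E \subseteq G$ with $G = UEU$. A group $F$ acting on a set $Y$ acts freely if for all non-identity $k \in F$ and all $y \in Y$ we have $ky \neq y$. *)

(* Defs.v *)
From HB Require Import structures.
From mathcomp Require Import all_boot.
From mathcomp Require Import boolp classical_sets functions cardinality reals.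
From mathcomp Require Import topology.

Set Implicit Arguments.
Unset Strict Implicit.
Unset Printing Implicit Defensive.

Local Open Scope classical_set_scope.
Local Open Scope group_scope.

HB.structure Definition PreTopologicalGroup :=
  {G of Topological G & Group G}.

HB.mixin Record PreTopologicalGroup_isTopologicalGroup G
    & PreTopologicalGroup G := {
  mulg_continuous : continuous (fun x : G * G => x.1 * x.2) ;
  invg_continuous : continuous (fun x : G => x^-1)
}.

#[short(type="topologicalGroupType")]
HB.structure Definition TopologicalGroup :=
  {G of PreTopologicalGroup G & PreTopologicalGroup_isTopologicalGroup G}.

Definition separable (T : topologicalType) :=
  exists2 D : set T, countable D & dense D.

Definition completely_metrizable (R : realType) (T : topologicalType) :=
  exists (M : metricType R) (f : T -> M) (g : M -> T),
    [/\ cancel f g, cancel g f, continuous f, continuous g &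
        forall F : set_system M,
          ProperFilter F -> cauchy F -> exists l : M, F --> l].

Definition polish (R : realType) (T : topologicalType) :=
  separable T /\ completely_metrizable R T.

Section Subgroups.
Variable G : groupType.
Implicit Types (A B H X F : set G) (x : G).

Definition is_subgroup H :=
  [/\ H 1, forall x y, H x -> H y -> H (x * y) & forall x, H x -> H x^-1].

Definition subgroup_generated X : set G :=
  \bigcap_(H in [set H | is_subgroup H /\ X `<=` H]) H.

Definition commutative_subset A :=
  forall x y, A x -> A y -> x * y = y * x.

Definition set_mulg A B : set G := [set a * b | a in A & b in B].

Definition ltranslate x A : set G := [set x * a | a in A].

Definition coset_space H : set (set G) := [set ltranslate x H | x in setT].

Definition finite_index H := finite_set (coset_space H).

(* A letter is a pair (x, b), standing for x if b is false and for the formal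
   inverse of x if b is true. *)
Definition letter_inv (l : G * bool) : G * bool := (l.1, ~~ l.2).

Definition letter_val (l : G * bool) : G := if l.2 then l.1^-1 else l.1.

Definition reduced_word (w : seq (G * bool)) : bool :=
  sorted (fun l m => m != letter_inv l) w.

Definition word_val (w : seq (G * bool)) : G := \prod_(l <- w) letter_val l.

Definition free_basis X F :=
  F = subgroup_generated X /\
  forall w : seq (G * bool), (forall l, l \in w -> X l.1) ->
    reduced_word w -> w != [::] -> word_val w <> 1.

Definition acts_freely (Y : Type) (F : set G) (act : G -> Y -> Y)
    (S : set Y) :=
  forall k, F k -> k <> 1 -> forall y, S y -> act k y <> y.

End Subgroups.

Section TopologicalGroups.
Variable G : topologicalGroupType.

Definition non_archimedean :=
  forall U : set G, open U -> U 1 ->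
    exists V : set G, [/\ open V, is_subgroup V & V `<=` U].

Definition roelcke_precompact :=
  forall U : set G, open U -> U 1 ->
    exists E : set G, finite_set E /\
      [set: G] = set_mulg (set_mulg U E) U.

Definition open_finite_residual : set G :=
  \bigcap_(H in [set H : set G | [/\ is_subgroup H, open H & finite_index H]])
    H.

End TopologicalGroups.

Arguments non_archimedean G : clear implicits.
Arguments roelcke_precompact G : clear implicits.
Arguments open_finite_residual G : clear implicits.

(* Main.v *)
Require Import Defs.
From mathcomp Require Import all_boot order ssralg ssrnum archimedean.
From mathcomp Require Import boolp classical_sets functions cardinality reals.
From mathcomp Require Import topology.

(** For an open subgroup [U], call a coset [a] of an open subgroup algebraic over
    [U] when its [U]-orbit is finite; if [U] is the pointwise stabilizer of a
    finite tuple in a countable structure, these are the elements of the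
    imaginary algebraic closure of the tuple.  A coset of an open subgroup of
    infinite index is not algebraic over [G].

    The generators are limits of a back-and-forth construction.  A finite stage
    is a coset [f U], thought of as the partial map that [f] induces on the
    points algebraic over [U].  Draw an edge from [a] to [f a], labelled by the
    generator, whenever [a] is algebraic over [U] and not over [G].  If the
    graph obtained from both generators is a forest at each stage, then in the
    limit a nonempty reduced word never maps a non-algebraic point to itself.
    This is the freeness of the action; it also makes the generators free,
    because a residual [G°] different from the trivial group forces some open
    subgroup to have infinite index, so that non-algebraic points exist.

    The forest is preserved by the extension step ([extension]).  To enlarge the
    domain of [f] from [U] to [W], first shrink [W] until all points met so far
    are algebraic over it, and then multiply [f] by an element of [U] for which
    every new point of the domain is sent outside the algebraic closure of [W]:
    each new edge hangs a new leaf on the old graph.  Such an element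
    exists by P. M. Neumann's lemma ([separation_finite]).  The lemma concerns
    finite sets of points, while algebraic closures are infinite; Roelcke
    precompactness reduces one to the other ([separation]).  An arbitrary
    element of the coset [p W] sends new points outside the closure of [W] as
    soon as [p] does, since [W] permutes these points; so the property passes
    to the limit.

    Two points remain.  The generators have to lie in [G°], so each stage keeps
    [f U] within reach of every open subgroup of finite index
    ([near_residual]); Roelcke precompactness shows that this can be tested on a
    single such subgroup ([near_residual_detect]).  And the decreasing cosets of
    the successive stages need a common point although a complete metric on [G]
    need not be invariant; extending domains and ranges alternately makes the
    stages converge on both sides, and this suffices
    ([decreasing_cosets_meet]).

    In the proof the forest is rooted by a height function and, for each
    point, the one label leading to lower height ([tree_generators]).  A
    reduced walk first descends and then ascends, and so cannot close up
    ([no_closed_walk]). *)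

Set Implicit Arguments.
Unset Strict Implicit.
Unset Printing Implicit Defensive.

Import Order.TTheory GRing.Theory Num.Theory.

Local Open Scope classical_set_scope.
Local Open Scope group_scope.

(** * Subgroups, cosets and algebraic points *)

Section Subgroups.
Context (G : groupType).
Implicit Types (U V W H K a b c : set G) (x y u : G).

Definition conj_set x H : set G := [set x * h * x^-1 | h in H].

Lemma ltranslateE x a y : ltranslate x a y <-> a (x^-1 * y).
Proof.
split=> [[z az <-]|a_y]; first by rewrite !gnorm.
by exists (x^-1 * y) => //; rewrite !gnorm.
Qed.

Lemma conj_setE x H y : conj_set x H y <-> H (x^-1 * y * x).
Proof.
split=> [[z Hz <-]|Hy]; first by rewrite !gnorm.
by exists (x^-1 * y * x) => //; rewrite !gnorm.
Qed.

Lemma ltranslateM x y a : ltranslate (x * y) a = ltranslate x (ltranslate y a).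
Proof. by apply/seteqP; split=> z; rewrite !ltranslateE !gnorm. Qed.

Lemma ltranslate1 a : ltranslate 1 a = a.
Proof. by apply/seteqP; split=> z; rewrite !ltranslateE !gnorm. Qed.

Lemma ltranslateK x a : ltranslate x^-1 (ltranslate x a) = a.
Proof. by rewrite -ltranslateM mulVg ltranslate1. Qed.

Lemma ltranslateKV x a : ltranslate x (ltranslate x^-1 a) = a.
Proof. by rewrite -ltranslateM mulgV ltranslate1. Qed.

Lemma subgroup1 H : is_subgroup H -> H 1. Proof. by case. Qed.

Lemma subgroupM H x y : is_subgroup H -> H x -> H y -> H (x * y).
Proof. by case=> _ HM _; apply: HM. Qed.

Lemma subgroupV H x : is_subgroup H -> H x -> H x^-1.
Proof. by case=> _ _; apply. Qed.

Lemma subgroupMl H x y : is_subgroup H -> H x -> H (x * y) <-> H y.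
Proof.
move=> sH Hx; split=> Hy; last exact: subgroupM.
by rewrite -[y](mulKg x); apply: subgroupM => //; apply: subgroupV.
Qed.

Lemma subgroupMr H x y : is_subgroup H -> H y -> H (x * y) <-> H x.
Proof.
move=> sH Hy; split=> Hx; last exact: subgroupM.
by rewrite -[x](mulgK y); apply: subgroupM => //; apply: subgroupV.
Qed.

Lemma is_subgroupT : is_subgroup [set: G]. Proof. by []. Qed.

Lemma is_subgroupI H K :
  is_subgroup H -> is_subgroup K -> is_subgroup (H `&` K).
Proof.
by move=> [H1 HM HV] [K1 KM KV]; split=> // [x y [? ?] [? ?]|x [? ?]];
  split; auto.
Qed.

Lemma is_subgroup_conj x H : is_subgroup H -> is_subgroup (conj_set x H).
Proof.
move=> sH; split=> [|y z|y]; rewrite !conj_setE.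
- by rewrite !gnorm; apply: subgroup1.
- by move=> Hy /(subgroupM sH Hy); rewrite !gnorm.
- by move=> /(subgroupV sH); rewrite !gnorm.
Qed.

Lemma conj_setT x : conj_set x [set: G] = [set: G].
Proof. by apply/seteqP; split=> y // _; apply/conj_setE. Qed.

Lemma conj_setM x y H : conj_set (x * y) H = conj_set x (conj_set y H).
Proof. by apply/seteqP; split=> z; rewrite !conj_setE !gnorm. Qed.

Lemma conj_set_id x H : is_subgroup H -> H x -> conj_set x H = H.
Proof.
move=> sH Hx; apply/seteqP; split=> y; rewrite conj_setE.
  by move=> /(subgroupMr _ sH Hx); rewrite subgroupMl//; apply: subgroupV.
by move=> Hy; apply/(subgroupMr _ sH Hx)/(subgroupMl _ sH (subgroupV sH Hx)).
Qed.

(** All elements of a coset of [H] conjugate [H] to the same group, so the range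
    of a partial map is determined by the coset that defines the map. *)
Lemma conj_set_coset x y H :
  is_subgroup H -> ltranslate x H y -> conj_set y H = conj_set x H.
Proof.
move=> sH /ltranslateE Hxy.
by rewrite -[y](mulVKg x) conj_setM (conj_set_id sH Hxy).
Qed.

Lemma decreasing_subset (U : nat -> set G) :
  (forall n, U n.+1 `<=` U n) -> forall n m, n <= m -> U m `<=` U n.
Proof.
move=> UP n m /subnK <-; elim: (m - n) => // k IH.
by apply: subset_trans IH; rewrite addSn.
Qed.

Lemma coset_chain (U : nat -> set G) (p : nat -> G) :
  (forall n, is_subgroup (U n)) -> (forall n, U n.+1 `<=` U n) ->
  (forall n, ltranslate (p n) (U n) (p n.+1)) ->
  forall n m, n <= m -> ltranslate (p n) (U n) (p m).
Proof.
move=> sU Udec pU n m /subnK <-; elim: (m - n) => [|k IH].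
  by apply/ltranslateE; rewrite mulVg; apply: subgroup1.
have /ltranslateE Uk := pU (k + n).
have /(subgroupM (sU n) ((ltranslateE _ _ _).1 IH)) :=
  decreasing_subset Udec (leq_addl k n) Uk.
by rewrite addSn => Un; apply/ltranslateE; move: Un; rewrite !gnorm.
Qed.

(** Points of all coset spaces [G/H] are treated uniformly as subsets of [G]
    under left translation.  The name refers to model theory: if [U] fixes a
    tuple of parameters, the points with finite [U]-orbit are those algebraic
    over the tuple. *)
Definition translates U a : set (set G) := [set ltranslate u a | u in U].

Definition algebraic U a := finite_set (translates U a).

Lemma sub_algebraic U V a : V `<=` U -> algebraic U a -> algebraic V a.
Proof. by move=> VU; apply: sub_finite_set; apply: image_subset. Qed.

Lemma algebraic_conj U x a :
  algebraic (conj_set x U) (ltranslate x a) <-> algebraic U a.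
Proof.
suff key y V b : algebraic V b -> algebraic (conj_set y V) (ltranslate y b).
  split=> [/(key x^-1)|]; last exact: key.
  rewrite ltranslateK -conj_setM mulVg; congr algebraic.
  by apply/seteqP; split=> z; rewrite conj_setE !gnorm.
move=> /(finite_image (ltranslate y)); apply: sub_finite_set.
move=> _ [_ [u Vu <-] <-]; exists (ltranslate u b); first by exists u.
by rewrite -!ltranslateM !gnorm.
Qed.

Lemma algebraic_ltranslate U x a :
  is_subgroup U -> U x -> algebraic U (ltranslate x a) <-> algebraic U a.
Proof. by move=> sU Ux; rewrite -{1}(conj_set_id sU Ux) algebraic_conj. Qed.

Lemma algebraic_coset U f p a : is_subgroup U -> ltranslate p U f ->
  algebraic (conj_set p U) (ltranslate f a) <-> algebraic U a.
Proof.
by move=> sU /(conj_set_coset sU) <-; rewrite algebraic_conj.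
Qed.

(** P. M. Neumann's separation lemma, by induction on [B].  For each [c] with an
    infinite orbit choose [g c] in [U] moving [c] out of [C].  By induction one
    [u] in [U] moves the points of [B] other than the head [b] off [C] and off
    all translates of [C] by [(g c)^-1], with [c] in [C]; then [u] and all the
    [g c * u] move them off [C].  If [u b] is not in [C], then [u] also works for
    [b]; otherwise [g (u b) * u] does. *)
Lemma separation_finite U (B C : seq (set G)) :
  is_subgroup U -> (forall b, b \in B -> ~ algebraic U b) ->
  exists2 u, U u & forall b, b \in B -> ltranslate u b \notin C.
Proof.
move=> sU; elim: B C => [|b B IH] C Bfree.
  by exists 1 => //; apply: subgroup1.
have /choice[g gP] : forall c, exists g,
    U g /\ (~ algebraic U c -> ltranslate g c \notin C).
  move=> c; have [ac|ac] := pselect (algebraic U c).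
    by exists 1; split=> //; apply: subgroup1.
  have [g Ug gC] : exists2 g, U g & ltranslate g c \notin C.
    apply: contrapT => noG; apply: ac; apply: (@sub_finite_set _ _ [set` C]).
      move=> _ [g Ug <-] /=; apply: contrapT => /negP gC.
      by apply: noG; exists g.
    exact/finite_seqP/(ex_intro _ C).
  by exists g.
pose hs := 1 :: [seq g c | c <- C].
have Uhs h : h \in hs -> U h.
  rewrite inE => /predU1P[->|/mapP[c _ ->]]; first exact: subgroup1.
  by have [] := gP c.
have [c cB|u Uu uB] := IH [seq ltranslate h^-1 d | h <- hs, d <- C].
  by apply: Bfree; rewrite inE cB orbT.
have [h h_hs hub] :
    exists2 h, h \in hs & ltranslate h (ltranslate u b) \notin C.
  have [ubC|ubC] := boolP (ltranslate u b \in C); last first.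
    by exists 1; rewrite ?ltranslate1// inE eqxx.
  exists (g (ltranslate u b)).
    by rewrite inE map_f ?orbT.
  have [_] := gP (ltranslate u b); apply.
  by rewrite algebraic_ltranslate//; apply: Bfree; rewrite inE eqxx.
exists (h * u) => [|c]; first by apply: subgroupM => //; apply: Uhs.
rewrite ltranslateM inE => /predU1P[->//|cB].
apply: contra (uB c cB) => hucC.
apply/allpairsP; exists (h, ltranslate h (ltranslate u c)).
by rewrite ltranslateK.
Qed.

End Subgroups.

(** * Separation and extension in Roelcke precompact groups *)

Section OpenSubgroups.
Context (G : topologicalGroupType).
Implicit Types (U V W H K N a b c : set G) (x y u f p : G).

Definition open_subgroup U := is_subgroup U /\ open U.

Lemma continuous_mulg_const x y : continuous (fun z : G => x * z * y).
Proof.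
have cmul (g h : G -> G) : continuous g -> continuous h ->
    continuous (fun z => g z * h z).
  move=> cg ch z.
  apply: (@continuous_comp _ _ _ (fun z => (g z, h z)) (fun t => t.1 * t.2)).
    by apply: cvg_pair; [apply: cg|apply: ch].
  exact: mulg_continuous.
apply: (cmul); last by move=> z; apply: cvg_cst.
by apply: (cmul) => z; [apply: cvg_cst|apply: cvg_id].
Qed.

Lemma open_ltranslate x a : open a -> open (ltranslate x a).
Proof.
move=> oa; rewrite (_ : ltranslate x a = (fun z => x^-1 * z * 1) @^-1` a).
  by move/continuousP: (@continuous_mulg_const x^-1 1); apply.
by apply/seteqP; split=> z; rewrite ltranslateE /preimage /= !gnorm.
Qed.

Lemma open_conj x a : open a -> open (conj_set x a).
Proof.
move=> oa; rewrite (_ : conj_set x a = (fun z => x^-1 * z * x) @^-1` a).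
  by move/continuousP: (@continuous_mulg_const x^-1 x); apply.
by apply/seteqP; split=> z; rewrite conj_setE.
Qed.

Lemma open_subgroupT : open_subgroup [set: G].
Proof. by split; [exact: is_subgroupT|exact: openT]. Qed.

Lemma open_subgroupI U V :
  open_subgroup U -> open_subgroup V -> open_subgroup (U `&` V).
Proof.
by move=> [sU oU] [sV oV]; split; [exact: is_subgroupI|exact: openI].
Qed.

Lemma open_subgroup_conj x U : open_subgroup U -> open_subgroup (conj_set x U).
Proof.
by move=> [sU oU]; split; [exact: is_subgroup_conj|exact: open_conj].
Qed.

Definition open_finite_index K := open_subgroup K /\ finite_index K.

Lemma finite_indexI H K : finite_index H -> finite_index K ->
  finite_index (H `&` K).
Proof.
move=> fH fK; apply: sub_finite_set (finite_image2 setI fH fK).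
move=> _ [x _ <-]; exists (ltranslate x H); first by exists x.
exists (ltranslate x K); first by exists x.
by apply/seteqP; split=> z; rewrite /setI /= !ltranslateE.
Qed.

Lemma finite_index_conj x H : finite_index H -> finite_index (conj_set x H).
Proof.
move=> /(finite_image (fun c => [set t * x^-1 | t in c])).
apply: sub_finite_set => _ [y _ <-]; exists (ltranslate (y * x) H).
  by exists (y * x).
apply/seteqP; split=> z.
  move=> [t /ltranslateE Ht <-]; apply/ltranslateE/conj_setE.
  by move: Ht; rewrite !gnorm.
move=> /ltranslateE/conj_setE Hz; exists (z * x); last by rewrite !gnorm.
by apply/ltranslateE; move: Hz; rewrite !gnorm.
Qed.

Lemma bigcap_mem_cons (T : eqType) e (s : seq T) (K : T -> set G) :
  \bigcap_(i in [set` e :: s]) K i = K e `&` \bigcap_(i in [set` s]) K i.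
Proof.
apply/seteqP; split=> x.
  move=> sx; split; first by apply: sx; rewrite /= inE eqxx.
  by move=> i si; apply: sx; rewrite /= inE si orbT.
by move=> [ex sx] i; rewrite /= inE => /predU1P[->//|]; apply: sx.
Qed.

Lemma open_finite_index_bigcap (T : eqType) (s : seq T) (K : T -> set G) :
  (forall e, e \in s -> open_finite_index (K e)) ->
  open_finite_index (\bigcap_(e in [set` s]) K e).
Proof.
elim: s => [|e s IH] sK.
  rewrite set_nil bigcap_set0; split; first exact: open_subgroupT.
  apply: sub_finite_set (finite_set1 [set: G]) => _ [x _ <-] /=.
  by apply/seteqP; split=> y // _; apply/ltranslateE.
rewrite bigcap_mem_cons.
have [oe fe] := sK e (mem_head _ _).
have [|os fs] := IH; first by move=> i si; apply: sK; rewrite inE si orbT.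
by split; [exact: open_subgroupI|exact: finite_indexI].
Qed.

Definition normal_open_finite_index K :=
  open_finite_index K /\ forall x, conj_set x K = K.

Lemma normal_core K : open_finite_index K ->
  exists2 N, normal_open_finite_index N & N `<=` K.
Proof.
move=> [[sK oK] fK]; have [s sE] := (finite_seqP _).1 fK.
have /choice[r rP] : forall c : set G, exists x : G,
    c \in s -> ltranslate x K = c.
  move=> c; have [cs|] := boolP (c \in s); last by exists 1.
  have : coset_space K c by rewrite sE.
  by move=> [x _ <-]; exists x.
pose N := \bigcap_(c in [set` s]) conj_set (r c) K.
have NE x : N x <-> forall y, conj_set y K x.
  split=> [Nx y|KxP c _]; last exact: KxP.
  have cs : ltranslate y K \in s.
    have : coset_space K (ltranslate y K) by exists y.
    by rewrite sE.
  rewrite (@conj_set_coset _ (r (ltranslate y K))) ?rP//; first exact: Nx.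
  by apply/ltranslateE; rewrite mulVg; apply: subgroup1.
exists N; last first.
  by move=> x /NE/(_ 1); rewrite conj_setE !gnorm.
split; first by apply: open_finite_index_bigcap => c _; split;
  [exact: open_subgroup_conj|exact: finite_index_conj].
have sub x : conj_set x N `<=` N.
  move=> y /conj_setE/NE NyP; apply/NE => z.
  by move: (NyP (x^-1 * z)); rewrite !conj_setE !gnorm.
move=> x; apply/seteqP; split; first exact: sub.
by move=> y Ny; apply/conj_setE/(sub x^-1)/conj_setE; rewrite !gnorm.
Qed.

Lemma normal_open_finite_index_bigcap (s : seq G) (K : G -> set G) :
  (forall e, normal_open_finite_index (K e)) ->
  exists2 N, normal_open_finite_index N &
    forall e, e \in s -> N `<=` K e.
Proof.
move=> nK; exists (\bigcap_(e in [set` s]) K e); last first.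
  by move=> e es; apply: bigcap_inf.
split; first by apply: open_finite_index_bigcap => e _; case: (nK e).
have sub x : conj_set x (\bigcap_(e in [set` s]) K e) `<=`
             \bigcap_(e in [set` s]) K e.
  move=> y /conj_setE sy e es; have [_ /(_ x) <-] := nK e.
  by apply/conj_setE/sy.
move=> x; apply/seteqP; split; first exact: sub.
by move=> y Ny; apply/conj_setE/(sub x^-1)/conj_setE; rewrite !gnorm.
Qed.

Lemma algebraic_finite_index U K a : is_subgroup U -> open_finite_index K ->
  algebraic (U `&` K) a -> algebraic U a.
Proof.
move=> sU [[sK _] fK] fa.
have /choice[r rP] : forall c : set G, exists x : G,
    (exists2 u, U u & c = ltranslate u K) -> U x /\ c = ltranslate x K.
  move=> c; have [[u Uu cE]|] := pselect (exists2 u, U u & c = ltranslate u K).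
    by exists u.
  by exists 1.
have /sub_finite_set : translates U a `<=` \bigcup_(c in coset_space K)
    [set ltranslate (r c) b | b in translates (U `&` K) a].
  move=> _ [u Uu <-]; exists (ltranslate u K); first by exists u.
  have [|Ur rE] := rP (ltranslate u K); first by exists u.
  set x := r _ in Ur rE *; exists (ltranslate (x^-1 * u) a); last first.
    by rewrite -ltranslateM !gnorm.
  exists (x^-1 * u) => //; split.
    by apply: subgroupM => //; apply: subgroupV.
  apply/ltranslateE; rewrite -rE; apply/ltranslateE.
  by rewrite mulVg; apply: subgroup1.
by apply; apply: bigcup_finite => // c _; apply: finite_image.
Qed.

(** Here infinitely many points are moved at once.  If every [u] in [U] had a
    bad point [a] then, for [V := W `&` S], a bad point for one element of
    [U] in a double coset [V e V] would yield, after translation by an element of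
    [V], a bad point for each other element of that double coset.  As there are
    finitely many double cosets and the points involved have finite [W]-orbits
    and finite [S]-orbits of images, finite sets [B] and [C] would account for
    the failure of all [u], against [separation_finite]. *)
Lemma separation U W S :
  roelcke_precompact G -> open_subgroup U -> open_subgroup W ->
  open_subgroup S -> W `<=` U ->
  exists2 u, U u & forall a, algebraic W a -> ~ algebraic U a ->
    ~ algebraic S (ltranslate u a).
Proof.
move=> rG [sU oU] [sW oW] [sS oS] WU.
have [sV oV] := open_subgroupI (conj sW oW) (conj sS oS).
have [E [finE GE]] := rG _ oV (subgroup1 sV).
apply: contrapT => noG.
have /choice[bad badP] : forall u, exists a, U u ->
    [/\ algebraic W a, ~ algebraic U a & algebraic S (ltranslate u a)].
  move=> u; have [Uu|] := pselect (U u); last by exists set0.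
  apply: contrapT => noA; apply: noG; exists u => // a Wa Ua Sa.
  by apply: noA; exists a.
(* [r e] represents the double coset of [e] by an element of [U], if any *)
have /choice[r rP] : forall e, exists u, forall v1 v2,
    (W `&` S) v1 -> (W `&` S) v2 -> U (v1 * e * v2) ->
    U u /\ exists w1 w2, [/\ (W `&` S) w1, (W `&` S) w2 & u = w1 * e * w2].
  move=> e; have [[v1 [v2 [Vv1 Vv2 Uv]]]|noV] := pselect (exists v1 v2,
    [/\ (W `&` S) v1, (W `&` S) v2 & U (v1 * e * v2)]).
    by exists (v1 * e * v2) => *; split=> //; exists v1, v2.
  by exists 1 => v1 v2 Vv1 Vv2 Uv; case: noV; exists v1, v2.
pose E' := E `&` [set e | U (r e)].
have finE' : finite_set E' by apply: finite_setIl.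
pose B := \bigcup_(e in E') translates W (bad (r e)).
pose C := \bigcup_(e in E') translates S (ltranslate (r e) (bad (r e))).
have /finite_seqP[sB BE] : finite_set B.
  by apply: bigcup_finite => // e [_ /badP[]].
have /finite_seqP[sC CE] : finite_set C.
  by apply: bigcup_finite => // e [_ /badP[]].
have [b bB|u Uu uB] := @separation_finite _ _ sB sC sU.
  have : B b by rewrite BE.
  move=> [e [_ /badP[_ Ub _]] [w Ww <-]].
  by rewrite algebraic_ltranslate//; apply: WU.
have : [set: G] u by [].
rewrite GE => -[_ [v1 Vv1 [e Ee <-]] [v2 Vv2 uE]].
have [|Ur [w1 [w2 [Vw1 Vw2 rE]]]] := rP e v1 v2 Vv1 Vv2; first by rewrite uE.
have E'e : E' e by [].
have ueq : u = v1 * w1^-1 * r e * (w2^-1 * v2) by rewrite rE -uE !gnorm.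
have Vl := subgroupM sV Vv1 (subgroupV sV Vw1).
have Vr := subgroupM sV (subgroupV sV Vw2) Vv2.
pose b := ltranslate (w2^-1 * v2)^-1 (bad (r e)).
have bB : b \in sB.
  have : B b.
    by exists e => //; exists (w2^-1 * v2)^-1 => //; case: (subgroupV sV Vr).
  by rewrite BE.
move/negP: (uB _ bB); apply.
have : C (ltranslate u b).
  exists e => //; exists (v1 * w1^-1); first by case: Vl.
  by rewrite /b -!ltranslateM ueq !gnorm.
by rewrite CE.
Qed.

(** The stage [f U] is compatible with a limit in the intersection of the open
    subgroups of finite index.  Testing only normal subgroups makes
    the condition depend on the double coset [U f U] alone; by [normal_core]
    nothing is lost. *)
Definition near_residual U f :=
  forall K, normal_open_finite_index K -> exists2 u, U u & K (f * u).

Lemma near_residual_inv U f : is_subgroup U -> near_residual U f ->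
  near_residual (conj_set f U) f^-1.
Proof.
move=> sU Uf K nK; have [[[sK _] _] KJ] := nK; have [u Uu Kfu] := Uf _ nK.
exists (f * u^-1 * f^-1); first by exists u^-1 => //; apply: subgroupV.
by move: (subgroupV sK Kfu); rewrite !gnorm.
Qed.

(** Whether [x W] meets [K] depends, for normal [K], only on the double coset
    [W x W].  There are finitely many double cosets; for each one that fails the
    test take a witness of the failure, and intersect these witnesses. *)
Lemma near_residual_detect W : roelcke_precompact G -> open_subgroup W ->
  exists2 K, normal_open_finite_index K &
    forall x w, W w -> K (x * w) -> near_residual W x.
Proof.
move=> rG [sW oW]; have [E [/finite_seqP[s ->] GE]] := rG _ oW (subgroup1 sW).
have nT : normal_open_finite_index [set: G].
  split; last exact: conj_setT.
  split; first exact: open_subgroupT.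
  apply: sub_finite_set (finite_set1 [set: G]) => _ [x _ <-] /=.
  by apply/seteqP; split=> y // _; apply/ltranslateE.
have /choice[K KP] : forall e, exists K, normal_open_finite_index K /\
    ((exists2 w, W w & K (e * w)) -> near_residual W e).
  move=> e; have [|/existsNP[K]] := pselect (near_residual W e).
    by exists [set: G].
  by move=> /not_implyP[nK noW]; exists K.
have [|N nN NK] := @normal_open_finite_index_bigcap s K.
  by move=> e; case: (KP e).
have conjN M x y : normal_open_finite_index M -> M (x * y) -> M (y * x).
  by move=> [_ /(_ y) MJ] Mxy; rewrite -MJ conj_setE !gnorm.
exists N => // x w Ww Nxw.
have : [set: G] x by [].
rewrite GE => -[_ [w1 Ww1 [e Ee <-]] [w2 Ww2 xE]].
have eW : near_residual W e.
  have [_] := KP e; apply; exists (w2 * w * w1).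
    by do 2!apply: subgroupM => //.
  apply: NK => //; move: Nxw; rewrite -xE -!mulgA => /(conjN _ _ _ nN).
  by rewrite !gnorm.
move=> M nM; have [v Wv Mev] := eW M nM; exists (w2^-1 * v * w1^-1).
  by do 2?apply: subgroupM => //; apply: subgroupV.
by rewrite -xE !gnorm -!mulgA; apply: (conjN _ _ _ nM); rewrite !gnorm.
Qed.

(** The extension step.  Replace [f] by a member [f1] of [f U] lying in a
    subgroup [K] that detects [near_residual W]; then any [p] in
    [f1 (U `&` K)] is admissible.  Since [K] has finite index, [U `&` K] has the
    same algebraic points as [U], so [separation] applies to it. *)
Lemma extension U W f :
  roelcke_precompact G -> open_subgroup U -> open_subgroup W -> W `<=` U ->
  near_residual U f ->
  exists p, [/\ ltranslate f U p, near_residual W p &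
    forall a, algebraic W a -> ~ algebraic U a ->
      ~ algebraic W (ltranslate p a)].
Proof.
move=> rG oU oW WU Uf; have [K nK KW] := near_residual_detect rG oW.
have [[oK fK] _] := nK; have sK := oK.1.
have [u0 Uu0 Kf1] := Uf K nK; set f1 := f * u0 in Kf1.
have [||u [Uu Ku] uP] := @separation (U `&` K) (W `&` K) (conj_set f1^-1 W) rG
  (open_subgroupI oU oK) (open_subgroupI oW oK).
- exact: open_subgroup_conj.
- by apply: setSI.
exists (f1 * u); split.
- by apply/ltranslateE; rewrite !gnorm; apply: subgroupM => //; case: oU.
- apply: (KW _ 1); first by apply: subgroup1; case: oW.
  by rewrite mulg1; apply: subgroupM.
- move=> a Wa Ua.
  have Wa' : algebraic (W `&` K) a by apply: sub_algebraic Wa => x [].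
  have Ua' : ~ algebraic (U `&` K) a.
    by move=> /(algebraic_finite_index oU.1 (conj oK fK)).
  by move=> /(algebraic_conj _ f1^-1 _).2;
    rewrite -ltranslateM mulKg; apply: uP.
Qed.

End OpenSubgroups.

(** * Intersections of decreasing cosets in Polish groups *)

Section Polish.
Context (R : realType) (G : topologicalGroupType).
Hypothesis polishG : polish R G.
Implicit Types (U V O : set G) (x y : G).

Definition converges (x : nat -> G) l := forall O, open O -> O l ->
  exists N, forall n, N <= n -> O (x n).

Lemma small_radius (e : R) : (0 < e)%R -> exists n : nat, (n.+1%:R^-1 <= e)%R.
Proof.
move=> e0; exists (Num.truncn e^-1)%R.
by rewrite -[leRHS]invrK lef_pV2 ?posrE ?invr_gt0// ltW// truncnS_gt.
Qed.

(** Completeness in terms of neighbourhoods alone; [beta n x] stands for the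
    ball of radius [1 / (n + 1)] around [x]. *)
Lemma polish_shrinking : exists beta : nat -> G -> set G,
  (forall n x, open (beta n x) /\ beta n x x) /\
  forall x : nat -> G, (forall n m, n <= m -> beta n (x n) (x m)) ->
    exists l, converges x l.
Proof.
have [_ [M [f [g [fK gK cf cg compl]]]]] := polishG.
exists (fun n x => f @^-1` (ball (f x) (n.+1%:R^-1)%R)°); split.
  move=> n x; split.
    by move/continuousP: cf; apply; exact: open_interior.
  by apply: nbhsx_ballx; rewrite invr_gt0 ltr0Sn.
move=> x xP; pose F := (f \o x) @ \oo.
have [|l Fl] := compl F.
  apply: cauchy_exP => e /small_radius[n ne]; exists (f (x n)).
  exists n => // m /= nm; apply: (le_ball ne).
  by apply: interior_subset; apply: (xP n m).
exists (g l) => O oO Ogl.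
have /Fl[N _ NP] : nbhs l (g @^-1` O).
  apply: open_nbhs_nbhs; split=> //.
  by move/continuousP: cg; apply.
by exists N => n /NP; rewrite /preimage /= fK.
Qed.

Lemma polish_base : non_archimedean G -> exists B : nat -> set G,
  (forall n, open_subgroup (B n)) /\
  forall O, open O -> O 1 -> exists n, B n `<=` O.
Proof.
move=> nG; have [_ [M [f [g [fK gK cf cg _]]]]] := polishG.
have /choice[B BP] : forall n : nat, exists V,
    open_subgroup V /\ V `<=` f @^-1` (ball (f 1) (n.+1%:R^-1)%R).
  move=> n; have [||V [oV sV VP]] :=
    nG (f @^-1` (ball (f 1) (n.+1%:R^-1)%R)°).
  - by move/continuousP: cf; apply; exact: open_interior.
  - by apply: nbhsx_ballx; rewrite invr_gt0 ltr0Sn.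
  - by exists V; split=> // x /VP/interior_subset.
exists B; split=> [n|O oO O1]; first by case: (BP n).
have /nbhs_ballP[e /= /small_radius[n ne] eO] : nbhs (f 1) (g @^-1` O).
  apply: open_nbhs_nbhs; split; last by rewrite /preimage /= fK.
  by move/continuousP: cg; apply.
exists n => x /(BP n).2 /(le_ball ne) /eO; by rewrite /preimage /= fK.
Qed.

Lemma polish_separated x : x <> 1 -> exists O, [/\ open O, O 1 & ~ O x].
Proof.
move=> x1; have [_ [M [f [g [fK gK cf cg _]]]]] := polishG.
have : f 1 != f x by apply/eqP => /(can_inj fK) /esym.
have := @metric_hausdorff R M; rewrite open_hausdorff => /[apply].
move=> [[A B] /= [/set_mem A1 /set_mem Bx] [oA _ /eqP AB]].
exists (f @^-1` A); split=> //.
  by move/continuousP: cf; apply.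
by move=> Ax; have : (A `&` B) (f x) by []; rewrite AB.
Qed.

Lemma converges_ltranslate (x : nat -> G) l U y N : open_subgroup U ->
  converges x l -> (forall n, N <= n -> ltranslate y U (x n)) ->
  ltranslate y U l.
Proof.
move=> [sU oU] xl xU.
have [||N' lx] := xl (ltranslate l U); first exact: open_ltranslate.
  by apply/ltranslateE; rewrite mulVg; apply: subgroup1.
have /ltranslateE lU := lx (maxn N N') (leq_maxr _ _).
have /ltranslateE yU := xU (maxn N N') (leq_maxl _ _).
apply/ltranslateE; move: (subgroupM sU yU (subgroupV sU lU)).
by rewrite !gnorm.
Qed.

(** Polish groups are complete for the two-sided uniformity: if [U n] and its
    conjugate by [p n] both shrink to [1], the cosets [p n U n] have a common
    point.  As the complete metric is not invariant, the [p n] need not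
    converge for it.  Instead a common point is found as a product [lx * ly] of
    two elements each of which is the limit of a sequence controlled by the
    metric.  The sequences satisfy [x i * y i = p (m i)]; they are corrected
    alternately, [x] inside a left coset [x i * A i] and [y] inside a right
    coset [B i * y i], each correction being harmless to the other factor
    because [U] resp. its conjugate is already small compared with the cosets
    chosen before. *)
Lemma decreasing_cosets_meet (U : nat -> set G) (p : nat -> G) :
  non_archimedean G ->
  (forall n, open_subgroup (U n)) -> (forall n, U n.+1 `<=` U n) ->
  (forall n, ltranslate (p n) (U n) (p n.+1)) ->
  (forall V, open_subgroup V -> exists n, U n `<=` V) ->
  (forall V, open_subgroup V -> exists n, conj_set (p n) (U n) `<=` V) ->
  exists l, forall n, ltranslate (p n) (U n) l.
Proof.
move=> nG oU Udec pU Usmall Rsmall.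
have [beta [betaP complete]] := polish_shrinking.
have sU n : is_subgroup (U n) by case: (oU n).
have pchain := coset_chain sU Udec pU.
have pchainR n m : n <= m -> conj_set (p n) (U n) (p m * (p n)^-1).
  by move=> /pchain/ltranslateE Unm; apply/conj_setE; rewrite !gnorm.
have Rdec n m : n <= m -> conj_set (p m) (U m) `<=` conj_set (p n) (U n).
  move=> nm; rewrite -(conj_set_coset (sU n) (pchain n m nm)) => x.
  by rewrite !conj_setE; apply: decreasing_subset.
have shrink V O x : open_subgroup V -> open O -> O x ->
    exists A, [/\ open_subgroup A, A `<=` V & forall z, A z -> O (x * z)].
  move=> oV oO Ox; have [||A [oA sA AP]] := nG (ltranslate x^-1 O).
  - exact: open_ltranslate.
  - by apply/ltranslateE; rewrite !gnorm.
  exists (V `&` A); split; first exact: open_subgroupI.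
    by move=> z [].
  by move=> z [_ /AP/ltranslateE]; rewrite !gnorm.
have shrink' V O x : open_subgroup V -> open O -> O x ->
    exists A, [/\ open_subgroup A, A `<=` V & forall z, A z -> O (z * x)].
  move=> oV oO Ox.
  have [A [oA AV AO]] := shrink _ _ _ (open_subgroup_conj x^-1 oV) oO Ox.
  exists (conj_set x A); split; first exact: open_subgroup_conj.
    by move=> z /conj_setE/AV/conj_setE; rewrite !gnorm.
  by move=> z /conj_setE/AO; rewrite !gnorm.
(* a state (i, m, x, A) consists of a stage, an index into [p], the left factor
   and the subgroup confining its later values *)
pose inv (s : nat * nat * G * set G) := let: (i, m, x, A) := s in
  [/\ open_subgroup A, forall z, A z -> beta i x (x * z) &
      conj_set (p m) (U m) `<=` conj_set x A].
pose step (s s' : nat * nat * G * set G) (B : set G) (k : nat) :=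
  let: (i, m, x, A) := s in let: (i', m', x', A') := s' in
  let y := x^-1 * p m in
  [/\ i' = i.+1, [/\ i <= k, m <= k & k <= m'],
     [/\ open_subgroup B, B `<=` A, forall z, B z -> beta i y (z * y),
         conj_set y^-1 B `<=` U i & U k `<=` conj_set y^-1 B],
     x' = p k * y^-1 & A' `<=` B].
have nextE s : exists s', inv s -> inv s' /\ exists B k, step s s' B k.
  case: s => [[[i m] x] A].
  have [|ninv] := pselect (inv (i, m, x, A)); last by exists (0, 0, 1, set0).
  move=> [oA xA Rm]; pose y := x^-1 * p m.
  have [|||B [oB BAU yB]] := shrink' (A `&` conj_set y (U i)) (beta i y) y.
  - exact: open_subgroupI (open_subgroup_conj _ (oU i)).
  - exact: (betaP i y).1.
  - exact: (betaP i y).2.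
  have [n nB] := Usmall _ (open_subgroup_conj y^-1 oB).
  pose k := maxn n (maxn i m); pose x' := p k * y^-1.
  have [||A' [oA' A'B xA']] := shrink B (beta i.+1 x') x' oB.
  - exact: (betaP _ _).1.
  - exact: (betaP _ _).2.
  have [n' nA'] := Rsmall _ (open_subgroup_conj x' oA').
  exists (i.+1, maxn n' k, x', A') => _; split.
    by split=> //; apply: subset_trans nA'; apply: Rdec; exact: leq_maxl.
  exists B, k; split=> //.
    split; last exact: leq_maxr.
    - by apply: leq_trans (leq_maxr _ _); exact: leq_maxl.
    - by apply: leq_trans (leq_maxr _ _); exact: leq_maxr.
  split=> //.
  - by move=> z /BAU[].
  - by move=> z /conj_setE/BAU[_ /conj_setE]; rewrite !gnorm.
  - by apply: subset_trans nB; apply: decreasing_subset (leq_maxl _ _).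
have [A0 [oA0 _ A0P]] := shrink setT (beta 0 1) 1 (open_subgroupT G)
  (betaP 0 1).1 (betaP 0 1).2.
have [m0 m0P] := Rsmall _ (open_subgroup_conj 1 oA0).
have /choice[next nextP] := nextE.
pose st n := iter n next (0, m0, 1, A0).
have stP n : inv (st n).
  by elim: n => [|n /nextP[]//]; split.
pose m n := (st n).1.1.2; pose x n := (st n).1.2; pose A n := (st n).2.
pose y n := (x n)^-1 * p (m n).
have stE n : st n = (n, m n, x n, A n).
  elim: n => [//|n IH]; have [_ [B [k]]] := nextP _ (stP n).
  rewrite {1}IH -[next _]/(st n.+1) /m /x /A.
  by case: (st n.+1) => [[[i' m'] x'] A'] [-> _ _ _ _].
have invE n : [/\ open_subgroup (A n), forall z, A n z -> beta n (x n) (x n * z)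
    & conj_set (p (m n)) (U (m n)) `<=` conj_set (x n) (A n)].
  by have := stP n; rewrite stE.
have /choice[B /choice[k stepP]] n : exists B k,
    step (n, m n, x n, A n) (n.+1, m n.+1, x n.+1, A n.+1) B k.
  by rewrite -!stE; have [_] := nextP _ (stP n).
have Adec n : A n.+1 `<=` A n.
  by have [_ _ [_ BA _ _ _] _ AB] := stepP n; apply: subset_trans BA.
have Bdec n : B n.+1 `<=` B n.
  have [_ _ _ _ AB] := stepP n; have [_ _ [_ BA _ _ _] _ _] := stepP n.+1.
  by apply: subset_trans AB.
have sA n : is_subgroup (A n) by have [[]] := invE n.
have oB n : open_subgroup (B n) by have [_ _ []] := stepP n.
have sB n : is_subgroup (B n) by case: (oB n).
have xstep n : ltranslate (x n) (A n) (x n.+1).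
  have [_ [_ mk _] _ xE _] := stepP n; have [_ _ RA] := invE n.
  have /RA/conj_setE := pchainR _ _ mk.
  by rewrite xE => Az; apply/ltranslateE; move: Az; rewrite !gnorm.
have ystep n : ltranslate (y n)^-1 (B n) (y n.+1)^-1.
  have [_ [_ _ km] [_ _ _ _ UB] xE _] := stepP n.
  have /ltranslateE/UB/conj_setE/(subgroupV (sB n)) Bz := pchain _ _ km.
  apply/ltranslateE; rewrite /y xE -/(y n); move: Bz.
  by rewrite -/(y n) !gnorm.
have xchain := coset_chain sA Adec xstep.
have ychain := coset_chain sB Bdec ystep.
have [n j nj|lx xlx] := complete x.
  have [_ betax _] := invE n.
  by have /ltranslateE/betax := xchain n j nj; rewrite !gnorm.
have yB n j : n <= j -> B n (y j * (y n)^-1).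
  by move=> /ychain/ltranslateE/(subgroupV (sB n)); rewrite !gnorm.
have [n j nj|ly yly] := complete y.
  have [_ _ [_ _ betay _ _] _ _] := stepP n.
  by have /betay := yB n j nj; rewrite mulgVK.
exists (lx * ly) => n; have [_ [nk _ _] [_ _ _ BU _] xE AB] := stepP n.
have /ltranslateE/AB Blx : ltranslate (x n.+1) (A n.+1) lx.
  have [oA _ _] := invE n.+1; exact: converges_ltranslate oA xlx (xchain n.+1).
have /ltranslateE/BU Uly : ltranslate (y n) (conj_set (y n)^-1 (B n)) ly.
  apply: (@converges_ltranslate y _ _ _ n) => //.
    exact: open_subgroup_conj.
  move=> j /yB Bj; apply/ltranslateE/conj_setE.
  by move: Bj; rewrite !gnorm.
have /BU Ulx : conj_set (y n)^-1 (B n) ((y n)^-1 * ((x n.+1)^-1 * lx) * y n).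
  by apply/conj_setE; move: Blx; rewrite !gnorm.
have /ltranslateE Upk := pchain n _ nk.
apply/ltranslateE; move: (subgroupM (sU n) Upk (subgroupM (sU n) Ulx Uly)).
by rewrite xE -/(y n) !gnorm.
Qed.

End Polish.

(** * Two generators and a height function *)

Lemma first_success (P : nat -> Prop) n : P n -> exists m, P m /\
  forall k, k < m -> ~ P k.
Proof.
move=> Pn; have /ex_minnP[m /asboolP Pm mP] : exists m, `[< P m >].
  by exists n; apply/asboolP.
exists m; split=> // k; rewrite ltnNge => /negP km Pk; apply: km.
exact/mP/asboolP.
Qed.

Section Construction.
Context (R : realType) (G : topologicalGroupType).
Hypotheses (polishG : polish R G) (naG : non_archimedean G)
  (rG : roelcke_precompact G).
Implicit Types (U V W : set G) (v a : set G) (n : nat).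

(** A letter is a generator, given by the first component, or its formal
    inverse if the second component is true.  Unlike letters over elements of
    [G], these are distinct for the two generators by construction. *)
Definition letter := (bool * bool)%type.

Definition linv (l : letter) : letter := (l.1, ~~ l.2).

Lemma linvK : involutive linv.
Proof. by case=> i b; rewrite /linv /= negbK. Qed.

Lemma linv_neq l : linv l != l.
Proof. by case: l => i []; rewrite /linv xpair_eqE /= andbF. Qed.

(** One stage of the construction.  Values and domains are recorded for both
    generators and their inverses, so that extending a domain and extending a
    range are the same operation, for opposite letters. *)
Record partial_maps := PartialMaps {
  pmap_val : letter -> G;
  pmap_dom : letter -> set G }.

Definition coherent (s : partial_maps) := forall l,
  [/\ open_subgroup (pmap_dom s l), near_residual (pmap_dom s l) (pmap_val s l),
      pmap_val s (linv l) = (pmap_val s l)^-1 &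
      pmap_dom s (linv l) = conj_set (pmap_val s l) (pmap_dom s l)].

(** The second clause makes all points in the domains and ranges of stage [s]
    algebraic over the new domain of [l]; the fourth makes the images of the new
    points new, relative to all of these and to the new points themselves. *)
Definition extends_at (l : letter) V (s t : partial_maps) :=
  [/\ pmap_dom t l `<=` V, forall m, pmap_dom t l `<=` pmap_dom s m,
      ltranslate (pmap_val s l) (pmap_dom s l) (pmap_val t l),
      forall a, algebraic (pmap_dom t l) a -> ~ algebraic (pmap_dom s l) a ->
        ~ algebraic (pmap_dom t l) (ltranslate (pmap_val t l) a) &
      forall m, m != l -> m != linv l ->
        pmap_val t m = pmap_val s m /\ pmap_dom t m = pmap_dom s m].

Lemma extends_at_exists l V s : open_subgroup V -> coherent s ->
  exists t, coherent t /\ extends_at l V s t.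
Proof.
move=> oV cs.
pose W := V `&` (\bigcap_(m in [set` enum {: letter}]) pmap_dom s m).
have oW : open_subgroup W.
  apply: open_subgroupI => //; elim: (enum _) => [|m r IH].
    by rewrite set_nil bigcap_set0; exact: open_subgroupT.
  rewrite bigcap_mem_cons; apply: open_subgroupI => //.
  by case: (cs m).
have Wm m : W `<=` pmap_dom s m.
  by move=> x [_]; apply; rewrite /= mem_enum.
have [oU Uf _ _] := cs l.
have [p [Up Wp pP]] := extension rG oU oW (Wm l) Uf.
exists (PartialMaps
  (fun m => if m == l then p else if m == linv l then p^-1 else pmap_val s m)
  (fun m => if m == l then W else if m == linv l then conj_set p W
            else pmap_dom s m)).
split=> [m|]; last first.
  split; rewrite /= ?eqxx//; first by move=> x [].
  by move=> m /negPf-> /negPf->.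
have [-> /=|ml] := eqVneq m l.
  by rewrite eqxx (negPf (linv_neq l)) eqxx; split.
have [-> /=|ml'] := eqVneq m (linv l).
  rewrite linvK eqxx (negPf (linv_neq l)) eqxx invgK -conj_setM mulVg.
  split=> //; first exact: open_subgroup_conj.
    by apply: near_residual_inv => //; case: oW.
  by apply/seteqP; split=> x; rewrite conj_setE !gnorm.
rewrite /= (inj_eq (can_inj linvK)) (can2_eq linvK linvK).
by rewrite (negPf ml) (negPf ml'); exact: cs.
Qed.

(** The vertices of the forest: points that are algebraic over some open
    subgroup but not over the whole group. *)
Definition wandering v :=
  ~ algebraic [set: G] v /\ exists2 V, open_subgroup V & algebraic V v.

Lemma wandering_ltranslate x v : wandering v -> wandering (ltranslate x v).
Proof.
move=> [Gv [V oV Vv]]; split; last first.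
  by exists (conj_set x V); [exact: open_subgroup_conj|apply/algebraic_conj].
by rewrite -[X in algebraic X](conj_setT x) algebraic_conj.
Qed.

(** The graph on non-algebraic points whose edges are the actions of the two
    generators is a forest, rooted in the following way.  Let [W n] be the new
    domain at stage [n]; these groups decrease, and the height of a point is the
    least [n] for which it is algebraic over [W n].  The edge of the letter [l]
    at [v] appears at the stage [m] where [v] enters the domain of [l].
    If stage [m] extends [l], then [v] has height at most [m] and its image
    does not.  If it extends the inverse of [l], then the image is the old end of
    the edge and [v] the new leaf; here [v] has height [m.+1], so that its
    height determines [m] and hence [l]: the descending letter is unique. *)
Lemma tree_generators : exists (g : bool -> G) (height : set G -> nat)
    (parent : set G -> letter),
  (forall i, open_finite_residual G (g i)) /\
  forall v l, wandering v ->
    let v' := ltranslate (letter_val (g l.1, l.2)) v in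
    height v < height v' \/ (l = parent v /\ height v' < height v).
Proof.
have [B [oB Bbase]] := polish_base polishG naG.
(* every pair of a precision [k] and a letter is treated at some stage *)
pose task n : nat * letter := odflt (0, (true, true)) (unpickle n).
have taskP k l : exists n, task n = (k, l).
  by exists (pickle (k, l)); rewrite /task pickleK.
have /choice[next nextP] : forall ns : nat * partial_maps, exists t,
    coherent ns.2 -> coherent t /\
      extends_at (task ns.1).2 (B (task ns.1).1) ns.2 t.
  move=> [n s]; have [cs|] := pselect (coherent s); last by exists s.
  by have [t] := @extends_at_exists (task n).2 _ _ (oB (task n).1) cs; exists t.
pose s0 := PartialMaps (fun=> 1) (fun=> [set: G]).
pose st := nat_rect (fun=> partial_maps) s0 (fun n s => next (n, s)).
have cst n : coherent (st n).
  elim: n => [|n IH]; last by have [] := nextP (n, st n) IH.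
  move=> l; split; rewrite /= ?invg1 ?conj_setT//; first exact: open_subgroupT.
  move=> K [[[sK _] _] _]; exists 1 => //; rewrite mulg1.
  exact: subgroup1.
pose act n := (task n).2.
have ext n : extends_at (act n) (B (task n).1) (st n) (st n.+1).
  by have [] := nextP (n, st n) (cst n).
pose f n := pmap_val (st n); pose D n := pmap_dom (st n).
pose W n := D n.+1 (act n).
have oD n l : open_subgroup (D n l) by have [] := cst n l.
have sD n l : is_subgroup (D n l) by case: (oD n l).
have fV n l : f n (linv l) = (f n l)^-1 by have [] := cst n l.
have DV n l : D n (linv l) = conj_set (f n l) (D n l) by have [] := cst n l.
have act_case n l : l = act n \/ l = linv (act n) \/
    (f n.+1 l = f n l /\ D n.+1 l = D n l).
  have [->|la] := eqVneq l (act n); first by left.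
  have [->|la'] := eqVneq l (linv (act n)); first by right; left.
  by right; right; have [_ _ _ _] := ext n; apply.
have coset_inv n l x : ltranslate (f n l) (D n l) x ->
    ltranslate (f n (linv l)) (D n (linv l)) x^-1.
  move=> /ltranslateE/(subgroupV (sD n l)) Dx.
  apply/ltranslateE; rewrite fV DV; apply/conj_setE.
  by move: Dx; rewrite !gnorm.
have fstep n l : ltranslate (f n l) (D n l) (f n.+1 l).
  have fact : ltranslate (f n (act n)) (D n (act n)) (f n.+1 (act n)).
    by have [] := ext n.
  have [->//|[->|[-> _]]] := act_case n l.
    by rewrite (fV n.+1); exact: coset_inv.
  by apply/ltranslateE; rewrite mulVg; apply: subgroup1.
have WD n l : W n `<=` D n l by have [_ WD _ _ _] := ext n; apply: WD.
have Ddec n l : D n.+1 l `<=` D n l.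
  have [->|[->|[_ ->]]//] := act_case n l; first exact: WD.
  rewrite !DV -(conj_set_coset (sD n _) (fstep n _)) => x /conj_setE Wx.
  by apply/conj_setE; apply: (WD).
have WB n : W n `<=` B (task n).1 by have [] := ext n.
have Wdec n m : n <= m -> W m `<=` W n.
  by apply: decreasing_subset => k; apply: WD.
have Dsmall l V : open_subgroup V -> exists n, D n l `<=` V.
  move=> [sV oV]; have [k BV] := Bbase V oV (subgroup1 sV).
  have [n nE] := taskP k l; exists n.+1; apply: subset_trans BV.
  by have := WB n; rewrite /W /act nE.
have /choice[g gP] : forall i, exists x, forall n,
    ltranslate (f n (i, false)) (D n (i, false)) x.
  move=> i; apply: (decreasing_cosets_meet polishG naG) => // [V|V].
    exact: Dsmall.
  move=> /(Dsmall (linv (i, false)))[n nV]; exists n.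
  by rewrite -DV.
pose h l := letter_val (g l.1, l.2).
have hP n l : ltranslate (f n l) (D n l) (h l).
  case: l => i [] /=; last exact: gP.
  exact: (coset_inv n (i, false)).
have hV l : h (linv l) = (h l)^-1.
  by case: l => i []; rewrite /h /letter_val /= ?invgK.
have Wwandering v : wandering v -> exists n, algebraic (W n) v.
  move=> [_ [V [sV oV] Vv]]; have [k BV] := Bbase V oV (subgroup1 sV).
  have [n nE] := taskP k (true, true); exists n.
  apply: sub_algebraic Vv; apply: subset_trans BV.
  by have := WB n; rewrite nE.
have /choice[height heightP] : forall v, exists n, wandering v ->
    forall m, algebraic (W m) v <-> n <= m.
  move=> v; have [mv|] := pselect (wandering v); last by exists 0.
  have [n Wn] := Wwandering v mv.
  have [m [Wm mmin]] := @first_success (fun k => algebraic (W k) v) n Wn.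
  exists m => _ k; split=> [Wk|mk]; last exact: sub_algebraic (Wdec _ _ mk) Wm.
  by rewrite leqNgt; apply/negP => /mmin.
(* freshness survives the passage to the limit because [W n] permutes the points
   algebraic over [W n] and not over the previous domain *)
have fresh n v : algebraic (W n) v -> ~ algebraic (D n (act n)) v ->
    ~ algebraic (W n) (ltranslate (h (act n)) v).
  move=> Wv Dv; have [_ _ _ newP _] := ext n.
  have /ltranslateE Wx := hP n.+1 (act n).
  have := newP (ltranslate ((f n.+1 (act n))^-1 * h (act n)) v).
  rewrite -ltranslateM mulVKg; apply.
    by apply/(algebraic_ltranslate _ (sD n.+1 (act n)) Wx).
  by rewrite (algebraic_ltranslate _ (sD n (act n)))//; exact: (WD n _ _ Wx).
(* predecessor: [v] of height [m.+1] is the leaf of an edge born at stage [m] *)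
exists g, height, (fun v => linv (act (height v).-1)); split=> [i|v l mv /=].
  move=> H [sH oH fH]; have [N nN NH] := normal_core (conj (conj sH oH) fH).
  have [[oN _] _] := nN; have [sN _] := oN; apply: NH.
  have [n DN] := Dsmall (i, false) N oN.
  have [_ /(_ N nN)[u /DN Nu Nfu] _ _] := cst n (i, false).
  have Nf := subgroupM sN Nfu (subgroupV sN Nu).
  have /ltranslateE/DN/(subgroupM sN Nf) := gP i n.
  by rewrite -/(f n) !gnorm.
rewrite -/(h l); set v' := ltranslate _ v.
have mv' : wandering v' by apply: wandering_ltranslate.
have [m [Dm1 Dm]] : exists m, algebraic (D m.+1 l) v /\ ~ algebraic (D m l) v.
  have [Gv [V oV Vv]] := mv; have [n DV'] := Dsmall l V oV.
  have [[|m] [Dm mmin]] := @first_success (fun k => algebraic (D k l) v) n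
    (sub_algebraic DV' Vv); first by [].
  by exists m; split=> //; apply: mmin.
have [lE|[lE|[_ DE]]] := act_case m l; last by rewrite DE in Dm1.
  left; rewrite ltnNge; apply/negP => v'v; rewrite lE in Dm1 Dm.
  have := fresh m v Dm1 Dm; rewrite -lE; apply.
  by apply/heightP => //; apply: leq_trans v'v _; apply/heightP.
have vE : v = ltranslate (h (act m)) v'.
  by rewrite /v' lE hV ltranslateKV.
have Wv' : algebraic (W m) v'.
  move: Dm1; rewrite {1}vE lE DV.
  by rewrite (algebraic_coset _ (sD _ _))//; apply: hP.
have Dv' : ~ algebraic (D m (act m)) v'.
  by move=> Dv'; apply: Dm; rewrite vE lE DV (algebraic_coset _ (sD _ _)).
have Wv : ~ algebraic (W m) v by rewrite vE; apply: fresh.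
have hv : height v = m.+1.
  apply/eqP; rewrite eqn_leq; apply/andP; split.
    by apply/heightP => //; apply: sub_algebraic Dm1; apply: WD.
  by rewrite ltnNge; apply/negP => /(heightP v mv).
right; rewrite hv lE; split=> //; rewrite ltnS; exact/heightP.
Qed.

End Construction.

(** * Reduced words and walks in a forest *)

Section Words.
Context (G : groupType).
Implicit Types (l m : G * bool) (w : seq (G * bool)) (x : G) (v : set G).

Lemma letter_invK : involutive (@letter_inv G).
Proof. by case=> x b; rewrite /letter_inv /= negbK. Qed.

Lemma letter_inv_neq l : letter_inv l != l.
Proof. by case: l => x []; rewrite /letter_inv xpair_eqE /= andbF. Qed.

Lemma letter_val_inv l : letter_val (letter_inv l) = (letter_val l)^-1.
Proof. by case: l => x []; rewrite /letter_val /= ?invgK. Qed.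

Lemma word_val_nil : word_val [::] = 1 :> G.
Proof. by rewrite /word_val big_nil. Qed.

Lemma word_val_cons l w : word_val (l :: w) = letter_val l * word_val w.
Proof. by rewrite /word_val big_cons. Qed.

Lemma word_val_cat w1 w2 : word_val (w1 ++ w2) = word_val w1 * word_val w2.
Proof. by rewrite /word_val big_cat. Qed.

Lemma word_val_rcons w l : word_val (rcons w l) = word_val w * letter_val l.
Proof. by rewrite -cats1 word_val_cat word_val_cons word_val_nil mulg1. Qed.

Lemma word_val_rev w :
  word_val (rev [seq letter_inv l | l <- w]) = (word_val w)^-1.
Proof.
elim: w => [|l w IH]; first by rewrite word_val_nil invg1.
by rewrite /= rev_cons word_val_rcons word_val_cons IH letter_val_inv invgM.
Qed.

Lemma reduced_word_behead l w : reduced_word (l :: w) -> reduced_word w.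
Proof. by rewrite /reduced_word /=; exact: path_sorted. Qed.

Lemma reduced_word_belast w l : reduced_word (rcons w l) -> reduced_word w.
Proof.
by case: w => //= m w; rewrite /reduced_word /= rcons_path => /andP[].
Qed.

Definition word_on (X : set G) w := forall l, l \in w -> X l.1.

Lemma word_on_cons X l w : word_on X (l :: w) -> X l.1 /\ word_on X w.
Proof.
move=> Xw; split; first by apply: Xw; rewrite inE eqxx.
by move=> m mw; apply: Xw; rewrite inE mw orbT.
Qed.

Lemma word_on_rcons X w l : word_on X (rcons w l) -> X l.1 /\ word_on X w.
Proof.
move=> Xw; split; first by apply: Xw; rewrite mem_rcons inE eqxx.
by move=> m mw; apply: Xw; rewrite mem_rcons inE mw orbT.
Qed.

Lemma reduce_word X w : word_on X w -> exists u,
  [/\ word_on X u, reduced_word u & word_val u = word_val w].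
Proof.
elim: w => [|l w IH]; first by exists [::].
move=> /word_on_cons[Xl /IH[[|m u] [Xu ru uw]]].
  exists [:: l]; split=> //; last by rewrite !word_val_cons -uw.
  by move=> m; rewrite inE => /eqP->.
have [_ Xu'] := word_on_cons Xu.
have [mE|ml] := eqVneq m (letter_inv l).
  exists u; split=> //; first exact: reduced_word_behead ru.
  by rewrite word_val_cons -uw word_val_cons mE letter_val_inv mulVKg.
exists [:: l, m & u]; split; last by rewrite !word_val_cons -uw word_val_cons.
  by move=> k; rewrite inE => /predU1P[->//|]; apply: Xu.
by move: ru; rewrite /reduced_word /= ml.
Qed.

Lemma subgroup_generated_word X x : subgroup_generated X x ->
  exists w, [/\ word_on X w, reduced_word w & word_val w = x].
Proof.
move=> Xx; suff [w [Xw <-]] : exists w, word_on X w /\ word_val w = x.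
  exact: reduce_word.
apply: (Xx [set x | exists w, word_on X w /\ word_val w = x]); split.
  split.
  - by exists [::]; rewrite word_val_nil.
  - move=> _ _ [w1 [Xw1 <-]] [w2 [Xw2 <-]]; exists (w1 ++ w2).
    by rewrite word_val_cat; split=> // l; rewrite mem_cat => /orP[/Xw1|/Xw2].
  - move=> _ [w [Xw <-]]; exists (rev [seq letter_inv l | l <- w]).
    by rewrite word_val_rev; split=> // _ /[!mem_rev] /mapP[l /Xw lw ->].
move=> y Xy; exists [:: (y, false)]; split.
  by move=> l; rewrite inE => /eqP->.
by rewrite word_val_cons word_val_nil mulg1.
Qed.

Section Tree.
Context (X : set G) (P : set (set G)) (height : set G -> nat)
  (parent : set G -> G * bool).
Hypothesis P_ltranslate : forall x v, P v -> P (ltranslate x v).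
(** Each vertex has at most one neighbour below it, the one reached through its
    parent letter. *)
Hypothesis tree : forall v l, P v -> X l.1 ->
  let v' := ltranslate (letter_val l) v in
  height v < height v' \/ (l = parent v /\ height v' < height v).

Lemma parent_after_ascent v l : P v -> X l.1 ->
  height v < height (ltranslate (letter_val l) v) ->
  letter_inv l = parent (ltranslate (letter_val l) v).
Proof.
move=> Pv Xl up.
have [|[]//] := @tree _ (letter_inv l) (P_ltranslate (letter_val l) Pv) Xl.
by rewrite letter_val_inv ltranslateK ltnNge (ltnW up).
Qed.

(** Letters act from right to left.  Once a reduced walk ascends it keeps
    ascending, since the only way down is back along the last edge.  So either
    its last step, that of the head letter, is an ascent, or all its steps are
    descents. *)
Lemma walk_end l w v : P v -> word_on X (l :: w) -> reduced_word (l :: w) ->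
  let v' := ltranslate (word_val (l :: w)) v in
  letter_inv l = parent v' \/ height v' < height v.
Proof.
elim: w l => [|m w IH] l Pv /word_on_cons[Xl Xw] rw /=.
  rewrite word_val_cons word_val_nil mulg1.
  by have [/(parent_after_ascent Pv Xl)|[]] := tree Pv Xl; [left|right].
have := IH _ Pv Xw (reduced_word_behead rw).
rewrite [word_val (l :: _)]word_val_cons ltranslateM.
set v1 := ltranslate (word_val (m :: w)) v.
have Pv1 : P v1 by apply: P_ltranslate.
have [/(parent_after_ascent Pv1 Xl)|[lp down]] := tree Pv1 Xl; first by left.
case=> [mp|down1]; last by right; apply: ltn_trans down1.
by move: rw; rewrite /reduced_word /= lp -mp letter_invK eqxx.
Qed.

(** For the same reason a walk whose first step, that of the last letter, is an
    ascent consists of ascents. *)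
Lemma walk_start w m v : P v -> word_on X (rcons w m) ->
  reduced_word (rcons w m) ->
  m = parent v \/ height v < height (ltranslate (word_val (rcons w m)) v).
Proof.
elim/last_ind: w m v => [|w l IH] m v Pv Xw rw.
  have [Xm _] := word_on_cons Xw.
  rewrite word_val_cons word_val_nil mulg1.
  by have [|[]] := tree Pv Xm; [right|left].
have [Xm Xw'] := word_on_rcons Xw; have rw' := reduced_word_belast rw.
have [up|[]] := tree Pv Xm; last by left.
rewrite word_val_rcons ltranslateM.
have [lp|up'] := IH l _ (P_ltranslate (letter_val m) Pv) Xw' rw'.
  have ml := parent_after_ascent Pv Xm up; rewrite -lp in ml.
  move: rw; rewrite /reduced_word -ml; case: (w) => [|k u] /=.
    by rewrite letter_invK eqxx.
  by rewrite !rcons_path last_rcons letter_invK eqxx !andbF.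
by right; apply: ltn_trans up'.
Qed.

(** A closed walk starts and ends at the same height, so by [walk_start] and
    [walk_end] its first step descends by the parent letter of [v] and its last
    step ascends by the inverse of that letter.  Removing both steps leaves a
    shorter reduced closed walk at the parent of [v]. *)
Lemma no_closed_walk w v : P v -> word_on X w -> reduced_word w ->
  w != [::] -> ltranslate (word_val w) v <> v.
Proof.
have [n wn] := ubnP (size w); elim: n w v wn => // n IH [//|l w] v.
rewrite ltnS /= => wn Pv Xw rw _ wv.
have [lp|] := walk_end Pv Xw rw; last by rewrite wv ltnn.
rewrite wv in lp.
case/lastP: w => [|w m] in wn Xw rw wv *.
  have [] := @walk_start [::] l v Pv Xw rw; last by rewrite wv ltnn.
  by rewrite -lp => /esym/eqP; rewrite (negPf (letter_inv_neq l)).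
have [mp|] := @walk_start (l :: w) m v Pv Xw rw; last by rewrite wv ltnn.
have [Xl Xwm] := word_on_cons Xw; have [Xm Xw'] := word_on_rcons Xwm.
have rwm := reduced_word_behead rw.
have lm : letter_val l = (letter_val m)^-1.
  by rewrite mp -lp letter_val_inv invgK.
apply: (IH w (ltranslate (letter_val m) v)) => //.
- by apply: leq_trans wn; rewrite size_rcons.
- exact: P_ltranslate.
- exact: reduced_word_belast rwm.
- apply/eqP => w0; move: rw; rewrite w0 /reduced_word /=.
  by rewrite mp -lp eqxx.
- rewrite -{2}wv word_val_cons word_val_rcons lm -!ltranslateM.
  by rewrite !gnorm.
Qed.

End Tree.
End Words.

(** * The free subgroup *)

Theorem theorem1p3 (R : realType) (G : topologicalGroupType) :
  polish R G -> non_archimedean G -> roelcke_precompact G ->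
  open_finite_residual G <> [set 1] ->
  exists f g : G,
    [/\ open_finite_residual G f, open_finite_residual G g &
        exists F : set G,
          [/\ free_basis [set f; g] F, ~ commutative_subset F &
              forall H : set G, is_subgroup H -> open H -> ~ finite_index H ->
                acts_freely F (@ltranslate G) (coset_space H)]].
Proof.
move=> polishG naG rG resG.
have [g [height [parent [gres tree]]]] := tree_generators polishG naG rG.
pose X := [set g true; g false].
have treeX v l : @wandering G v -> X l.1 ->
    let v' := ltranslate (letter_val l) v in
    height v < height v' \/
    (l = (g (parent v).1, (parent v).2) /\ height v' < height v).
  case: l => z b mv [] /= ->.
    by have [|[<-]] := tree v (true, b) mv; [left|right].
  by have [|[<-]] := tree v (false, b) mv; [left|right].
have free w v : wandering v -> word_on X w -> reduced_word w -> w != [::] ->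
    ltranslate (word_val w) v <> v.
  exact: (no_closed_walk (@wandering_ltranslate G) treeX).
have coset_wandering H x : open_subgroup H -> ~ finite_index H ->
    wandering (ltranslate x H).
  move=> oH fH; apply: wandering_ltranslate; split=> //; exists H => //.
  apply: sub_finite_set (finite_set1 H) => _ [y Hy <-] /=.
  have oH1 := oH.1; apply/seteqP; split=> z; rewrite ltranslateE.
    by move/(subgroupMl _ oH1 (subgroupV oH1 Hy)).
  by move/(subgroupMl _ oH1 (subgroupV oH1 Hy)).
(* if all open subgroups had finite index they would separate points, and the
   residual would be trivial *)
have [v mv] : exists v, @wandering G v.
  have [k [kres k1]] : exists k, open_finite_residual G k /\ k <> 1.
    apply: contrapT => nok; apply: resG; apply/seteqP; split=> x.
      by move=> xres; apply: contrapT => x1; apply: nok; exists x.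
    by move=> -> H [sH _ _]; apply: subgroup1.
  have [O [oO O1 Ok]] := polish_separated polishG k1.
  have [V [oV sV VO]] := naG O oO O1.
  exists (ltranslate 1 V); apply: coset_wandering => // fV.
  by apply: Ok; apply: VO; apply: kres.
(* equal generators would give two letters with the same action at each point,
   so no letter could descend anywhere *)
have gneq : g true <> g false.
  move=> gE; have up b u : wandering u ->
      height u < height (ltranslate (letter_val (g true, b)) u).
    move=> mu; have [//|[trueP _]] := tree u (true, b) mu.
    by have /= [|[]] := tree u (false, b) mu; rewrite -gE -?trueP.
  have := up true _ (wandering_ltranslate (letter_val (g true, false)) mv).
  rewrite -[letter_val (g true, true)]/((letter_val (g true, false))^-1).
  rewrite ltranslateK.
  by rewrite ltnNge (ltnW (up false v mv)).
have freeX w : word_on X w -> reduced_word w -> w != [::] -> word_val w <> 1.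
  by move=> Xw rw w0 w1; apply: (free w v mv Xw rw w0); rewrite w1 ltranslate1.
exists (g true), (g false); split=> //; exists (subgroup_generated X); split.
- by split.
- move=> comm; pose x := g true; pose y := g false.
  have Xgen z : X z -> subgroup_generated X z by move=> Xz H [_]; apply.
  have xy : x * y = y * x by apply: comm; apply: Xgen; [left|right].
  apply: (freeX [:: (x, false); (y, false); (x, true); (y, true)]) => //.
  + by move=> l; rewrite !inE => /or4P[] /eqP->; [left|right|left|right].
  + rewrite /reduced_word /= /letter_inv !xpair_eqE /= !andbF !andbT /=.
    exact/eqP.
  + by rewrite !word_val_cons word_val_nil /letter_val /= !mulgA xy !gnorm.
- move=> H sH oH fH k Fk k1 _ [x _ <-].
  have [w [Xw rw wk]] := subgroup_generated_word Fk.
  rewrite -wk; apply: free => //; first exact: coset_wandering.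
  by apply/eqP => w0; apply: k1; rewrite -wk w0 word_val_nil.
Qed.
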